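(* Let $p\ge1$ and let $K\subset\mathbf{R}^N$ be compact. Suppose that there are $N$ linearly independent directions such that, for each of these directions, the set of lines in that direction which intersect $K$ has $(N-1)$-dimensional Lebesgue measure zero. Then the $J_p$-property holds for $K$.
   Context: For $\Omega$ open, $W^{1,p}(\Omega)$ is the usual Sobolev space: $u\in L^p(\Omega)$ with weak first derivatives and $\sum_{|\alpha|\le1}\|D^\alpha u\|_{L^p(\Omega)}<\infty$. $W^{1,p}(\Omega,\mathbf{R}^N)$ denotes the set of functions $\mathbf{R}^N\to\mathbf{R}$ whose restriction to $\Omega$ is in $W^{1,p}(\Omega)$. Capacity: for compact $F\subset\mathbf{R}^N$, $C_{1,p}(F)=\inf\{\sum_{|\alpha|\le1}\|D^\alpha\varphi\|_{L^p(\mathbf{R}^N)}:\varphi\in C_0^\infty(\mathbf{R}^N),\ \varphi|_F\ge1\}$; for open $\omega$, $C_{1,p}(\omega)=\sup\{C_{1,p}(F):F\subset\omega\text{ compact}\}$. A measurable $u:\mathbf{R}^N\to\mathbf{R}$ is quasicontinuous if for every $\epsilon>0$ there is an open $\omega$ with $C_{1,p}(\omega)<\epsilon$ and $u|_{\mathbf{R}^N\setminus\omega}$ continuous; $Q$ is the set of quasicontinuous functions on $\mathbf{R}^N$. $K$ has the $J_p$-property (quasicontinuous version) if $Q\cap W^{1,p}(K^c,\mathbf{R}^N)=Q\cap W^{1,p}(\mathbf{R}^N)$, where $K^c=\mathbf{R}^N\setminus K$. A set of parallel lines is measured by the $(N-1)$-dimensional Lebesgue measure of its intersection with a hyperplane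 perpendicular to the lines. *)

(* Defs.v *)
From HB Require Import structures.
From mathcomp Require Import all_boot all_order all_algebra.
From mathcomp Require Import all_classical all_reals all_analysis.

Set Implicit Arguments.
Unset Strict Implicit.
Unset Printing Implicit Defensive.
Import Order.TTheory GRing.Theory Num.Theory.
Import numFieldTopology.Exports numFieldNormedType.Exports.
Local Open Scope classical_set_scope.
Local Open Scope ring_scope.

(** R^n is 'rV[R]_n, with the library's (sup norm) topology. As a measurable
    type it carries the product sigma-algebra, i.e. the Borel sets; for the
    Lebesgue-measurable sets see lebesgueTypeRV below. *)
Definition rV_display : measure_display.
Proof. exact: default_measure_display. Qed.

Section measurable_rV.
Context (R : realType) (n : nat).

Definition rV_coord (i : 'I_n) (v : 'rV[R]_n) : measurableTypeR R := v ord0 i.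

HB.instance Definition _ := @isMeasurable.Build rV_display 'rV[R]_n
  (g_sigma_preimage rV_coord)
  (@sigma_algebra0 _ _ _) (@sigma_algebraC _ _) (@sigma_algebra_bigcup _ _ _).

Lemma measurable_rV_coord (i : 'I_n) : measurable_fun [set: 'rV[R]_n] (rV_coord i).
Proof.
move=> _ Y mY; rewrite setTI; apply: sub_sigma_algebra => /=.
rewrite -bigcup_seq/=; exists i => /=; first by rewrite mem_index_enum.
by exists Y => //; rewrite setTI.
Qed.

Lemma measurable_fun_rV d (T : measurableType d) (f : T -> 'rV[R]_n) :
  (forall i, measurable_fun [set: T] (rV_coord i \o f)) ->
  measurable_fun [set: T] f.
Proof.
move=> mf _ Y mY; rewrite setTI; move: Y mY.
apply: smallest_sub.
  split; first by rewrite preimage_set0; exact: measurable0.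
  - by move=> A mA; rewrite setTD preimage_setC; exact: measurableC.
  - by move=> A mA; rewrite preimage_bigcup; exact: bigcup_measurable.
move=> A; rewrite -bigcup_seq/= => -[i _ [B mB <-]].
rewrite setTI -comp_preimage -[X in measurable X]setTI; exact: mf.
Qed.

End measurable_rV.

Section lebesgue_rV.
Context (R : realType).
Local Open Scope ereal_scope.

Definition rV_cons n (x : R) (v : 'rV[R]_n) : 'rV[R]_n.+1 :=
  row_mx (x%:M : 'rV_1) v.

(** Up to the identification of R^(n+1) with R * R^n by rV_cons, this is the
    iterated product measure, see product_measure1; R^0 has measure 1. *)
Fixpoint lebesgue_rV n : set 'rV[R]_n -> \bar R :=
  if n is n'.+1 then
    fun A => \int[lebesgue_measure]_x lebesgue_rV [set v | A (rV_cons (n := n') x v)]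
  else fun A => \d_(0%R : 'rV[R]_0) A.

Let cons_pair n (z : measurableTypeR R * 'rV[R]_n) := rV_cons z.1 z.2.
Let uncons n (v : 'rV[R]_n.+1) : measurableTypeR R * 'rV[R]_n :=
  (v ord0 ord0, \row_i v ord0 (lift ord0 i)).

Let rV_cons0 n x (v : 'rV[R]_n) : rV_cons x v ord0 ord0 = x.
Proof.
have E : lshift n (ord0 : 'I_1) = ord0 by exact/val_inj.
have := row_mxEl (x%:M : 'rV_1) v ord0 ord0; rewrite E => H; apply: (etrans H).
by rewrite mxE eqxx mulr1n.
Qed.

Let rV_consS n x (v : 'rV[R]_n) i : rV_cons x v ord0 (lift ord0 i) = v ord0 i.
Proof.
have E : rshift 1 i = lift ord0 i by exact/val_inj.
by have := row_mxEr (x%:M : 'rV_1) v ord0 i; rewrite E.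
Qed.

Let consK n : cancel (@cons_pair n) (@uncons n).
Proof.
case=> x v; rewrite /uncons /cons_pair /= rV_cons0; congr pair.
by apply/rowP => i; rewrite mxE rV_consS.
Qed.

Let unconsK n : cancel (@uncons n) (@cons_pair n).
Proof.
move=> v; apply/rowP => i; rewrite /cons_pair /uncons /=.
by have [j ->|->] := unliftP ord0 i; rewrite ?rV_consS ?rV_cons0 ?mxE.
Qed.

Let measurable_cons_pair n : measurable_fun setT (@cons_pair n).
Proof.
apply: measurable_fun_rV => i; have [j ->|->] := unliftP ord0 i.
  rewrite (_ : _ \o _ = @rV_coord R n j \o snd); last first.
    by apply/funext => z; rewrite /rV_coord /= rV_consS.
  by apply: measurableT_comp; [exact: measurable_rV_coord|].
rewrite (_ : _ \o _ = fst); last first.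
  by apply/funext => z; rewrite /rV_coord /= rV_cons0.
exact: measurable_fst.
Qed.

Let measurable_uncons n : measurable_fun setT (@uncons n).
Proof.
apply: measurable_fun_pair; first exact: (measurable_rV_coord ord0).
apply: measurable_fun_rV => i.
rewrite (_ : _ \o _ = @rV_coord R _ (lift ord0 i)).
  exact: measurable_rV_coord.
by apply/funext => v; rewrite /rV_coord/= mxE.
Qed.

Let lebesgue_rV_ex n : exists m : {sigma_finite_measure set 'rV[R]_n -> \bar R},
  lebesgue_rV (n := n) = m.
Proof.
elim: n => [|n [m mE]].
  by exists (\d_(0%R : 'rV[R]_0)).
pose nu := pushforward (@lebesgue_measure R \x m) (@cons_pair n).
have nuE : lebesgue_rV (n := n.+1) = nu.
  rewrite /= mE; apply/funext => A; rewrite /nu /pushforward /product_measure1.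
  apply: eq_integral => x _ /=; congr (m _).
  by apply/seteqP; split => v; rewrite /xsection /= inE.
have mnu0 : nu set0 = 0.
  by rewrite /nu /pushforward preimage_set0 measure0.
have mnu_ge0 A : 0 <= nu A by rewrite /nu /pushforward.
have mnu_add : semi_sigma_additive nu.
  exact: (@measure_semi_sigma_additive _ _ _
    (@measure_function_pushforward__canonical__measure_function_Measure
      _ _ _ _ _ (@lebesgue_measure R \x m) _ (@measurable_cons_pair n))).
have nu_fin : sigma_finite setT nu.
  have /sigma_finiteP[F [TF ndF Foo]] := sigma_finiteT (@lebesgue_measure R).
  have /sigma_finiteP[G [TG ndG Goo]] := sigma_finiteT m.
  have mFG k : measurable (F k `*` G k).
    by apply: measurableX; [exact: (Foo k).1|exact: (Goo k).1].
  exists (fun k => @uncons n @^-1` (F k `*` G k)).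
    rewrite -preimage_bigcup; apply/esym; rewrite -subTset => v _ /=.
    have [i _ Fi] : (\bigcup_k F k) (uncons v).1 by rewrite -TF.
    have [j _ Gj] : (\bigcup_k G k) (uncons v).2 by rewrite -TG.
    exists (maxn i j) => //; split.
    - by move: Fi; exact/subsetPset/ndF/leq_maxl.
    - by move: Gj; exact/subsetPset/ndG/leq_maxr.
  move=> k; split.
    by rewrite -[X in measurable X]setTI; exact: measurable_uncons.
  rewrite /nu /pushforward -comp_preimage (_ : _ \o _ = id); last first.
    exact/funext/consK.
  rewrite preimage_id product_measure1E; [|exact: (Foo k).1|exact: (Goo k).1].
  by rewrite lte_mul_pinfty ?ge0_fin_numE ?measure_ge0 ?(Foo k).2 ?(Goo k).2.
rewrite nuE; move: nu mnu0 mnu_ge0 mnu_add nu_fin {nuE} => nu nu0 nu_ge0 nu_add nu_fin.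
pose nuM : {measure set 'rV[R]_n.+1 -> \bar R} :=
  HB.pack nu (isMeasure.Build _ _ _ nu nu0 nu_ge0 nu_add).
have nuM_fin : sigma_finite setT nuM by exact: nu_fin.
have nuME : nu = nuM by [].
clearbody nuM.
pose H1 := isSFinite.Build _ _ _ (nuM : set _ -> _) (sfinite_measure_sigma_finite nuM_fin).
pose H2 := isSigmaFinite.Build _ _ _ (nuM : set _ -> _) nuM_fin.
pose nuS := HB.pack_for {sigma_finite_measure set 'rV[R]_n.+1 -> \bar R}
  (Measure.sort nuM) H1 H2.
by exists nuS.
Qed.

Let lebesgue_rV0 n : lebesgue_rV (set0 : set 'rV[R]_n) = 0.
Proof. by have [m ->] := lebesgue_rV_ex n; exact: measure0. Qed.

Let lebesgue_rV_ge0 n (A : set 'rV[R]_n) : 0 <= lebesgue_rV A.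
Proof. by have [m ->] := lebesgue_rV_ex n; exact: measure_ge0. Qed.

Let lebesgue_rV_sigma_additive n : semi_sigma_additive (@lebesgue_rV n).
Proof.
by have [m ->] := lebesgue_rV_ex n; exact: measure_semi_sigma_additive.
Qed.

HB.instance Definition _ n := isMeasure.Build _ _ _ (@lebesgue_rV n)
  (@lebesgue_rV0 n) (@lebesgue_rV_ge0 n) (@lebesgue_rV_sigma_additive n).

Let lebesgue_rV_sigma_finite n : sigma_finite setT (@lebesgue_rV n).
Proof. by have [m ->] := lebesgue_rV_ex n; exact: sigma_finiteT. Qed.

HB.instance Definition _ n := Measure_isSigmaFinite.Build _ _ _
  (@lebesgue_rV n) (@lebesgue_rV_sigma_finite n).

End lebesgue_rV.

(** Lebesgue measure in the textbook sense, on the Lebesgue-measurable (not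
    only Borel) subsets of R^n; it vanishes exactly on the sets of outer
    measure zero. *)
Section completed_lebesgue_rV.
Context (R : realType) (n : nat).

Definition lebesgueTypeRV := caratheodory_type (@lebesgue_rV R n)^*%mu.
HB.instance Definition _ := Measurable.on lebesgueTypeRV.

Definition completed_lebesgue_rV : set lebesgueTypeRV -> \bar R :=
  @completed_measure_extension _ _ _ (@lebesgue_rV R n).
HB.instance Definition _ := Measure.on completed_lebesgue_rV.

Let sigmaT_finite_completed_lebesgue_rV : sigma_finite setT completed_lebesgue_rV.
Proof. exact/completed_measure_extension_sigma_finite/sigma_finiteT. Qed.

HB.instance Definition _ := Measure_isSigmaFinite.Build _ _ _
  completed_lebesgue_rV sigmaT_finite_completed_lebesgue_rV.

Definition lebesgue_measurable_fun (D : set 'rV[R]_n) (u : 'rV[R]_n -> R) :=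
  @measurable_fun _ _ lebesgueTypeRV R D u.

End completed_lebesgue_rV.

Section smooth.
Context (R : realType) (N : nat).
Implicit Types (phi : 'rV[R]_N -> R) (Omega : set 'rV[R]_N).

Definition partial (i : 'I_N) phi : 'rV[R]_N -> R := 'D_(delta_mx ord0 i) phi.

Definition iter_partial (s : seq 'I_N) phi := foldr partial phi s.

Definition smooth phi := forall s : seq 'I_N,
  continuous (iter_partial s phi) /\
  forall i x, derivable (iter_partial s phi) x (delta_mx ord0 i).

Definition tsupport phi : set 'rV[R]_N := closure [set x | phi x != 0].

(** C_0^oo(Omega), extended by zero outside Omega *)
Definition test_function Omega phi :=
  [/\ smooth phi, compact (tsupport phi) & tsupport phi `<=` Omega].

End smooth.

Section sobolev.
Context (R : realType) (N : nat) (p : R).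
Local Notation mu := (@completed_lebesgue_rV R N).
Implicit Types (u : 'rV[R]_N -> R) (g : 'I_N -> 'rV[R]_N -> R).
Implicit Types (Omega F K : set 'rV[R]_N).
Local Open Scope ereal_scope.

Definition Lp_norm Omega u : \bar R := 'N[mu]_(p%:E)[EFin \o (u \_ Omega)].

(** The sum of the L^p norms of D^alpha u over |alpha| <= 1, where g i stands
    for the i-th first-order derivative. *)
Definition sobolev_norm Omega u g : \bar R :=
  Lp_norm Omega u + \sum_(i < N) Lp_norm Omega (g i).

Definition weak_partial Omega u (i : 'I_N) (v : 'rV[R]_N -> R) :=
  forall phi, test_function Omega phi ->
    \int[mu]_(x in Omega) (u x * partial i phi x)%:E =
    - \int[mu]_(x in Omega) (v x * phi x)%:E.

(** W^{1,p}(Omega, R^N): functions on all of R^N, only the values on Omega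
    matter. With Omega = setT this is W^{1,p}(R^N). *)
Definition sobolev Omega : set ('rV[R]_N -> R) := [set u |
  lebesgue_measurable_fun Omega u /\
  exists g, [/\ forall i, lebesgue_measurable_fun Omega (g i),
                forall i, weak_partial Omega u i (g i) &
                sobolev_norm Omega u g < +oo]].

Definition compact_capacity F : \bar R :=
  ereal_inf [set sobolev_norm setT phi (fun i => partial i phi) | phi in
    [set phi | test_function setT phi /\ forall x, F x -> (1 <= phi x)%R]].

Definition open_capacity (omega : set 'rV[R]_N) : \bar R :=
  ereal_sup [set compact_capacity F | F in
    [set F | compact F /\ F `<=` omega]].

Definition quasicontinuous : set ('rV[R]_N -> R) := [set u |
  lebesgue_measurable_fun setT u /\
  forall eps : R, (0 < eps)%R -> exists omega,
    [/\ open omega, open_capacity omega < eps%:E &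
        {within ~` omega, continuous u}]].

Definition J_property K :=
  quasicontinuous `&` sobolev (~` K) = quasicontinuous `&` sobolev setT.

End sobolev.

Section lines.
Context (R : realType) (N : nat).
Implicit Types (d x : 'rV[R]_N) (K : set 'rV[R]_N) (A : set (set 'rV[R]_N)).

Definition line d x : set 'rV[R]_N := [set x + t *: d | t in [set: R]].

Definition lines_meeting d K : set (set 'rV[R]_N) :=
  [set L | (exists x, L = line d x) /\ L `&` K !=set0].

(** The rows of B are an orthonormal basis of the hyperplane perpendicular to
    d, so y |-> y *m B is an isometry of R^(N-1) onto that hyperplane. *)
Definition orthonormal_frame d (B : 'M[R]_(N.-1, N)) :=
  B *m B^T = 1%:M /\ d *m B^T = 0.

(** The set A of lines parallel to d has (N-1)-dimensional measure zero. The
    choice of the frame is immaterial, since Lebesgue measure is invariant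
    under isometries. *)
Definition null_lines d A := exists B, orthonormal_frame d B /\
  completed_lebesgue_rV [set y | exists2 L, A L & L (y *m B)] = 0%E.

End lines.

(* Main.v *)
Require Import Defs.
From mathcomp Require Import all_boot all_order all_algebra.
From mathcomp Require Import all_classical all_reals all_analysis.
From mathcomp Require Import measurable_realfun ring.

(** Fix one of the directions d and let P be the orthogonal projection along d.
    Since P(K) is compact and null, there are smooth functions chi_k, constant
    along d, with values in [0, 1], vanishing near K and tending to 1 almost
    everywhere. If phi is a test function on R^N, then phi * chi_k is one on the
    complement of K, and the derivative along d only acts on phi; so
    chi_k * (u d_d phi + (sum_i d_i g_i) phi) has integral zero, and dominated
    convergence removes chi_k. As the directions span R^N, the g_i are the weak
    partial derivatives of u on R^N. *)

Set Implicit Arguments.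
Unset Strict Implicit.
Unset Printing Implicit Defensive.
Import Order.TTheory GRing.Theory Num.Theory.
Import numFieldTopology.Exports numFieldNormedType.Exports.
Local Open Scope classical_set_scope.
Local Open Scope ring_scope.

(** * Lebesgue measure on row vectors *)

Section lebesgue_rV_theory.
Context (R : realType).
Local Open Scope ereal_scope.

(** The obstacle is that functions vanishing near K and close to 1 elsewhere have in general no
    useful gradient bound: K may have positive capacity. Constancy along d makes the only derivative
    of the cutoff that enters vanish identically, so that pointwise convergence is enough and the
    other derivatives may grow freely. The price is that each direction has its own cutoffs. They
    must disappear in the limit before the directions are combined; after that, the N relations
    concern the same N numbers, the integrals of [u * partial i phi + g i * phi], and linear algebra
    applies. Lebesgue measure is an iterated integral in the standard coordinates, whereas the
    projection is along an arbitrary direction. Translation invariance and Fubini carry null sets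
    back from R^(N-1) to R^N, in place of a change of variables. K lies in the cylinder over its own
    projection and is therefore null, so the values of u on K do not matter and the [g i] may be
    extended by zero. *)

Lemma rV_cons_ord0 n (x : R) (v : 'rV[R]_n) : rV_cons x v ord0 ord0 = x.
Proof.
have E : lshift n (ord0 : 'I_1) = ord0 by exact/val_inj.
have := row_mxEl (x%:M : 'rV_1) v ord0 ord0; rewrite E => H; apply: (etrans H).
by rewrite mxE eqxx mulr1n.
Qed.

Lemma rV_cons_lift n (x : R) (v : 'rV[R]_n) i :
  rV_cons x v ord0 (lift ord0 i) = v ord0 i.
Proof.
have E : rshift 1 i = lift ord0 i by exact/val_inj.
by have := row_mxEr (x%:M : 'rV_1) v ord0 i; rewrite E.
Qed.

Lemma measurable_rV_cons n :
  measurable_fun setT (fun z : measurableTypeR R * 'rV[R]_n => rV_cons z.1 z.2).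
Proof.
apply: measurable_fun_rV => i; have [j ->|->] := unliftP ord0 i.
  rewrite (_ : _ \o _ = @rV_coord R n j \o snd); last first.
    by apply/funext => z; rewrite /rV_coord /= rV_cons_lift.
  by apply: measurableT_comp; [exact: measurable_rV_coord|].
rewrite (_ : _ \o _ = fst); last first.
  by apply/funext => z; rewrite /rV_coord /= rV_cons_ord0.
exact: measurable_fst.
Qed.

Lemma measurable_rV_slice n (A : set 'rV[R]_n.+1) : measurable A ->
  measurable_fun setT (fun x : measurableTypeR R => lebesgue_rV [set v | A (rV_cons x v)]).
Proof.
move=> mA.
have mB := measurable_rV_cons (n := n) measurableT mA.
rewrite setTI in mB.
have := measurable_fun_xsection (@lebesgue_rV R n) mB.
congr measurable_fun; apply/funext => x /=; congr lebesgue_rV.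
by apply/seteqP; split => v; rewrite /xsection /= inE.
Qed.

Lemma measurable_fun_addrV d (T : measurableType d) n (f g : T -> 'rV[R]_n) :
  measurable_fun setT f -> measurable_fun setT g ->
  measurable_fun setT (fun z => (f z + g z)%R).
Proof.
move=> mf mg; apply: measurable_fun_rV => i.
rewrite (_ : _ \o _ = (@rV_coord R n i \o f) \+ (@rV_coord R n i \o g))%R; last first.
  by apply/funext => z; rewrite /rV_coord/= mxE.
by apply: measurable_funD; apply: measurableT_comp => //; exact: measurable_rV_coord.
Qed.

Lemma measurable_mulmxr m n (B : 'M[R]_(m, n)) :
  measurable_fun setT (fun x : 'rV[R]_m => x *m B).
Proof.
apply: measurable_fun_rV => i.
rewrite (_ : _ \o _ = fun x => \sum_(k < m) rV_coord k x * B k i)%R; last first.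
  by apply/funext => x; rewrite /rV_coord/= mxE.
apply: measurable_sum => k; apply: measurable_funM => //.
exact: measurable_rV_coord.
Qed.

Lemma lebesgue_measure_shift (a : R) (A : set R) : measurable A ->
  pushforward (@lebesgue_measure R) ((+%R^~ a) : _ -> measurableTypeR R) A = lebesgue_measure A.
Proof.
have ma : measurable_fun setT ((+%R^~ a) : measurableTypeR R -> measurableTypeR R).
  exact: (measurable_funD (@measurable_id _ _ _) (measurable_cst a)).
move=> mA; apply/esym/lebesgue_measure_unique => //= _ [[x y]] _ <-.
rewrite /pushforward (_ : _ @^-1` _ = `](x - a)%R, (y - a)%R]%classic); last first.
  by apply/seteqP; split => z /=; rewrite !in_itv/= ltrBlDr lerBrDr.
by rewrite !lebesgue_measure_itv/= !lte_fin ltrD2r -!EFinB opprB addrA subrK.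
Qed.

Lemma ge0_integral_shift (a : R) (f : R -> \bar R) :
  measurable_fun setT f -> (forall x, 0 <= f x) ->
  \int[lebesgue_measure]_x f (x + a)%R = \int[lebesgue_measure]_x f x.
Proof.
move=> mf f0.
have ma : measurable_fun setT ((+%R^~ a) : measurableTypeR R -> measurableTypeR R).
  exact: (measurable_funD (@measurable_id _ _ _) (measurable_cst a)).
transitivity (\int[pushforward (@lebesgue_measure R)
    ((+%R^~ a) : _ -> measurableTypeR R)]_x f x).
  by rewrite (ge0_integral_pushforward ma lebesgue_measure measurableT mf).
by apply: eq_measure_integral => A mA _; exact: lebesgue_measure_shift.
Qed.

(** Induction along the iterated integral: the outer one-dimensional integral absorbs the shift of
    the first coordinate, the inner measure that of the others. *)
Lemma lebesgue_rV_shift n (a : 'rV[R]_n) (A : set 'rV[R]_n) : measurable A ->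
  lebesgue_rV [set v | A (v + a)%R] = lebesgue_rV A.
Proof.
elim: n a A => [|n IH] a A mA.
  congr lebesgue_rV; apply/funext => v /=.
  by rewrite [(v + a)%R]thinmx0 [v]thinmx0.
pose a' : 'rV[R]_n := \row_i a ord0 (lift ord0 i).
rewrite /= -[RHS](ge0_integral_shift (a ord0 ord0)); last 2 first.
- exact: measurable_rV_slice.
- by move=> x; exact: measure_ge0.
apply: eq_integral => x _.
rewrite -[RHS](IH a'); last first.
  have := measurableT_comp (measurable_rV_cons (n := n))
    (pair1_measurable (x + a ord0 ord0 : measurableTypeR R)%R) measurableT mA.
  by rewrite setTI.
rewrite /=; congr lebesgue_rV; apply/funext => v /=; congr A; apply/rowP => i;
  have [j ->|->] := unliftP ord0 i;
  by rewrite mxE ?rV_cons_lift ?rV_cons_ord0 ?mxE.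
Qed.

(** Allows the total mass, infinite unless n = 0, to be cancelled from a vanishing product in
    Fubini's identity. *)
Lemma lebesgue_rV_setT_gt0 n : 0 < lebesgue_rV (setT : set 'rV[R]_n).
Proof.
elim: n => [|n IH] /=; first by rewrite diracE in_setT lte01.
rewrite (_ : (fun=> _) = cst (lebesgue_rV [set: 'rV[R]_n]))// integral_cst//.
have := @lebesgue_measure_itv R `]-oo, +oo[; rewrite set_itvNyy/= => T.
by rewrite mule_gt0// [ltRHS]T ltry.
Qed.

Definition cube n (M : R) : set 'rV[R]_n := [set v | forall i, `|v ord0 i| <= M]%R.
Arguments cube : clear implicits.

Lemma lebesgue_rV_cube n M : lebesgue_rV (cube n M) < +oo.
Proof.
elim: n => [|n IH] /=.
  by rewrite diracE; case: (_ \in _); rewrite ltry.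
rewrite (_ : (fun x => _) = (cst (lebesgue_rV (cube n M))) \_ `[(-M)%R, M]%classic).
  rewrite -integral_mkcond integral_cst//=.
  rewrite lebesgue_measure_itv/= -EFinB.
  have : lebesgue_rV (cube n M) \is a fin_num.
    by rewrite ge0_fin_numE ?measure_ge0.
  by move=> /fineK <-; case: ifPn => _; rewrite -EFinM ltry.
apply/funext => x; rewrite patchE; case: ifPn => [|/negP xM].
  rewrite inE/= in_itv/= -ler_norml => xM; congr lebesgue_rV.
  apply/seteqP; split => v /= vM i.
    by have := vM (lift ord0 i); rewrite rV_cons_lift.
  by have [j ->|->] := unliftP ord0 i; rewrite ?rV_cons_lift ?rV_cons_ord0.
rewrite (_ : [set v | _] = set0) ?measure0//.
apply/seteqP; split => v //= /(_ ord0); rewrite rV_cons_ord0 => vM; apply: xM.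
by rewrite inE/= in_itv/= -ler_norml.
Qed.

(* Fubini for (x, y) |-> 1_Z (f x + y): all its sections in y are translates of Z,
   and its sections in x are translates of the preimage of Z. *)
Lemma lebesgue_rV_preimage_null m n (f : 'rV[R]_m -> 'rV[R]_n) (s : 'rV[R]_n -> 'rV[R]_m)
    (Z : set 'rV[R]_n) :
  measurable_fun setT f -> (forall x y, f (x + s y)%R = (f x + y)%R) ->
  measurable Z -> lebesgue_rV Z = 0 -> lebesgue_rV (f @^-1` Z) = 0.
Proof.
move=> mf fs mZ Z0.
have mfZ : measurable (f @^-1` Z) by rewrite -[X in measurable X]setTI; exact: mf.
pose A := [set z : 'rV[R]_m * 'rV[R]_n | Z (f z.1 + z.2)%R].
have mA : measurable A.
  rewrite -[A]setTI; apply: measurable_fun_addrV => //.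
  by apply: measurableT_comp => //; exact: measurable_fst.
have := indic_fubini_tonelli (@lebesgue_rV R m) (@lebesgue_rV R n) mA.
rewrite indic_fubini_tonelli_FE// indic_fubini_tonelli_GE//.
under eq_integral => x _.
  rewrite /= (_ : xsection A x = [set y | Z (y + f x)%R]); last first.
    by apply/seteqP; split => y; rewrite /xsection/= inE /A/= addrC.
  rewrite lebesgue_rV_shift// Z0; over.
rewrite integral0.
under eq_integral => y _.
  rewrite /= (_ : ysection A y = [set x | (f @^-1` Z) (x + s y)%R]); last first.
    by apply/seteqP; split => x; rewrite /ysection/= inE /A/= fs.
  rewrite lebesgue_rV_shift//; over.
rewrite integral_cst//= => /esym/eqP; rewrite mule_eq0 => /orP[/eqP//|].
by rewrite gt_eqF// lebesgue_rV_setT_gt0.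
Qed.

End lebesgue_rV_theory.

(** * Null sets, and measurability of open sets, for the completed measure *)

Section completed_lebesgue_rV_theory.
Context (R : realType) (n : nat).
Local Notation mu := (@completed_lebesgue_rV R n).
Local Open Scope ereal_scope.

Lemma measurable_lebesgueTypeRV (A : set 'rV[R]_n) :
  measurable A -> measurable (A : set (lebesgueTypeRV R n)).
Proof. exact: caratheodory_measurable_mu_ext. Qed.

Lemma completed_lebesgue_rVE (A : set 'rV[R]_n) :
  measurable A -> mu A = lebesgue_rV A.
Proof. by move=> mA; exact: measurable_mu_extE. Qed.

(** The completed measure of A is an infimum over countable Borel covers, whether or not A is
    measurable. Covers of total mass below 1/(k+1) are united, and the unions are intersected over
    k. *)
Lemma completed_lebesgue_rV_null (A : set 'rV[R]_n) : mu A = 0 ->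
  exists Z, [/\ measurable Z, A `<=` Z & lebesgue_rV Z = 0].
Proof.
move=> A0.
have /choice[F HF] : forall k : nat, exists Z : set 'rV[R]_n,
    [/\ measurable Z, A `<=` Z & lebesgue_rV Z < (k.+1%:R^-1)%:E].
  move=> k; have : mu A < (k.+1%:R^-1)%:E by rewrite A0 lte_fin invr_gt0.
  move=> /ereal_inf_lt[_ [F [mF AF] <-] Fk].
  exists (\bigcup_i F i); split => //; first exact: bigcupT_measurable.
  apply: le_lt_trans Fk; apply: measure_sigma_subadditive => //.
  exact: bigcupT_measurable.
have mF : measurable (\bigcap_k F k).
  by apply: bigcapT_measurable => k; have [] := HF k.
exists (\bigcap_k F k); split => //.
  by move=> x Ax k _; have [_ + _] := HF k; exact.
apply/eqP; rewrite eq_le measure_ge0 andbT; apply/lee_addgt0Pr => e e0.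
rewrite add0e; have [k] := ltr_add_invr e0; rewrite add0r => ke.
have [mFk _ Fk] := HF k.
apply: (@le_trans _ _ (lebesgue_rV (F k))).
  by apply: le_measure; rewrite ?inE//; exact: bigcap_inf.
by apply: (le_trans (ltW Fk)); rewrite lee_fin ltW.
Qed.

Lemma sub_null_lebesgueTypeRV (A Z : set 'rV[R]_n) :
  measurable Z -> lebesgue_rV Z = 0 -> A `<=` Z ->
  measurable (A : set (lebesgueTypeRV R n)) /\ mu A = 0.
Proof.
move=> mZ Z0 AZ.
have muA0 : mu A = 0.
  apply/eqP; rewrite eq_le; apply/andP; split; last exact: mu_ext_ge0.
  by rewrite -Z0 -completed_lebesgue_rVE//; exact: le_mu_ext.
split => //; apply: measure_is_complete_caratheodory.
exists Z; split => //; first exact: measurable_lebesgueTypeRV.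
by rewrite -Z0; exact: completed_lebesgue_rVE.
Qed.

(** A base of the topology indexed by a countable type, so that [unpickle] enumerates it. The closed
    cubes serve as closed carriers of the bump functions. *)
Definition rat_cube (q : 'rV[rat]_n * nat) : set 'rV[R]_n :=
  [set v | forall i, `|v ord0 i - ratr (q.1 ord0 i)| < q.2.+1%:R^-1]%R.

Definition closed_rat_cube (q : 'rV[rat]_n * nat) : set 'rV[R]_n :=
  [set v | forall i, `|v ord0 i - ratr (q.1 ord0 i)| <= q.2.+1%:R^-1]%R.

Lemma open_rat_cube (U : set 'rV[R]_n) x : open U -> U x ->
  exists q, rat_cube q x /\ closed_rat_cube q `<=` U.
Proof.
rewrite openE => /[apply] /nbhs_ballP[e /= e0 xeU].
have [k] := ltr_add_invr (divr_gt0 e0 (ltr0n _ 2)); rewrite add0r => ke.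
have k0 : (0 < k.+1%:R^-1 :> R)%R by rewrite invr_gt0.
have /choice[c xc] : forall i : 'I_n, exists c : rat,
    (`|x ord0 i - ratr c| < k.+1%:R^-1)%R.
  move=> i; have /rat_in_itvoo[c] : (x ord0 i - k.+1%:R^-1 < x ord0 i + k.+1%:R^-1)%R.
    by rewrite ltrD2l gtrN.
  by rewrite in_itv/= => xc; exists c; rewrite distrC ltr_distl.
exists (\row_i c i, k); split => [i|v vc].
  by rewrite /= mxE.
apply: xeU; split => // i j; rewrite /ball_/= ord1.
have := vc j; rewrite /= mxE => vcj.
apply: (le_lt_trans (ler_distD (ratr (c j)) _ _)); rewrite [e]splitr ltrD//.
  exact: lt_trans (xc j) ke.
by rewrite distrC; exact: le_lt_trans vcj ke.
Qed.

Lemma measurable_rat_cube q : measurable (rat_cube q).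
Proof.
rewrite (_ : rat_cube q = \bigcap_(i in [set: 'I_n])
    ((@rV_coord R n i) @^-1` [set t | `|t - ratr (q.1 ord0 i)| < q.2.+1%:R^-1]%R)).
  apply: fin_bigcap_measurable => // i _; rewrite -[X in measurable X]setTI.
  apply: measurable_rV_coord => //.
  rewrite [X in measurable X](_ : _ =
    ball (ratr (q.1 ord0 i) : R) (q.2.+1%:R^-1)); first exact: measurable_ball.
  by apply/seteqP; split => t /=; rewrite /ball/= distrC.
by apply/seteqP; split => v /= vq i; [move=> _|]; exact: vq.
Qed.

(** The sigma-algebra is generated by the coordinates and not by the topology; rational cubes are
    finite intersections of coordinate conditions, and countably many of them fill U. *)
Lemma open_measurable_rV (U : set 'rV[R]_n) : open U -> measurable U.
Proof.
move=> oU.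
rewrite (_ : U = \bigcup_q (if `[< closed_rat_cube q `<=` U >] then rat_cube q else set0)).
  apply: countable_bigcupT_measurable => // q.
  by case: ifP => // _; exact: measurable_rat_cube.
apply/seteqP; split => [x /(open_rat_cube oU)[q [qx qU]]|x [q _]].
  by exists q => //; rewrite asboolT.
by case: asboolP => // qU qx; apply: qU => i; exact/ltW/qx.
Qed.

Lemma continuous_lebesgue_measurable_fun (f : 'rV[R]_n -> R) :
  continuous f -> lebesgue_measurable_fun setT f.
Proof.
move=> /continuousP cf; apply: (measurability _ (RGenOpens.measurableE R)).
move=> _ [_ [a [b ->] <-]]; rewrite setTI; apply: measurable_lebesgueTypeRV.
apply: open_measurable_rV; apply: cf; exact: interval_open.
Qed.

Lemma measurable_cube M : measurable (@cube R n M).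
Proof.
rewrite (_ : cube _ = \bigcap_(i in [set: 'I_n])
    ((@rV_coord R n i) @^-1` `[(- M)%R, M]%classic)).
  apply: fin_bigcap_measurable => // i _; rewrite -[X in measurable X]setTI.
  exact: measurable_rV_coord.
by apply/seteqP; split => v /= vq i; [move=> _|]; have := vq i;
  rewrite /rV_coord/= in_itv/= ler_norml// => /(_ I).
Qed.

Lemma compact_sub_cube (K : set 'rV[R]_n) : compact K -> exists M, K `<=` @cube R n M.
Proof.
move=> /compact_bounded[M [_ /(_ (M + 1)%R)]]; rewrite ltrDl => /(_ ltr01) KM.
exists (M + 1)%R => x /KM xM i; apply: le_trans xM.
by rewrite [leRHS]mx_normrE; apply/bigmax_geP; right; exists (ord0, i).
Qed.

End completed_lebesgue_rV_theory.

(** * Smooth cutoffs *)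

Section flat.
Context (R : realType).
Implicit Types (P : {poly R}) (t : R).

(** Term by term from y^i / i! <= exp y, which explains the factorials in the constant. *)
Lemma horner_expRN_bounded P : exists C : R, forall y, 0 <= y -> `|P.[y] * expR (- y)| <= C.
Proof.
exists (\sum_(i < size P) `|P`_i| * i`!%:R) => y y0.
rewrite horner_coef mulr_suml; apply: (le_trans (ler_norm_sum _ _ _)).
apply: ler_sum => i _; rewrite -mulrA normrM ler_wpM2l//.
rewrite ger0_norm ?mulr_ge0 ?exprn_ge0 ?expR_ge0// expRN ler_pdivrMr ?expR_gt0//.
(* The inequality 1 + y^i / i! <= exp y used below fails at y = 0 when i = 0. *)
case: (nat_of_ord i) => [|k]; first by rewrite expr0 fact0 mul1r -expR0 ler_expR.
rewrite mulrC -ler_pdivrMr ?ltr0n ?fact_gt0//.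
by apply: le_trans (expR_ge1Dxn k y0); rewrite lerDr.
Qed.

(* For smoothness of exp(-1/t): the family [flat P] is closed under differentiation. *)
Definition flat P t : R := if 0 < t then P.[t^-1] * expR (- t^-1) else 0.

(** With y = 1/t one has d/dt = - y^2 d/dy, and d/dy sends P(y) exp(-y) to (P' - P)(y) exp(-y). *)
Definition flat_deriv P : {poly R} := 'X^2 * (P - P^`()).

Lemma is_derive_flat P t : is_derive t 1 (flat P) (flat (flat_deriv P) t).
Proof.
have [t0|t0|->] := ltgtP t 0.
- rewrite [X in is_derive _ _ _ X](_ : _ = 0); last by rewrite /flat ltNge (ltW t0).
  apply: (near_eq_is_derive (f := cst 0)).
  near=> s; rewrite /flat ltNge (_ : s <= 0)//; near: s.
  exact: (cvgr_le t cvg_id).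
- pose f (s : R) : R := P.[s^-1] * expR (- s^-1).
  have ff : \near t, f t = flat P t.
    near=> s; rewrite /flat/f (_ : 0 < s)//; near: s.
    exact: (cvgr_gt t cvg_id).
  have dV : is_derive t (1 : R) (fun s : R => s^-1) (- t ^- 2).
    have := is_deriveV (lt0r_neq0 t0) (is_derive_id t (1 : R)).
    by rewrite scaler1.
  have dN : is_derive t (1 : R) (fun s : R => - s^-1) (t ^- 2).
    by have := is_deriveN dV; rewrite opprK.
  have dP := is_derive1_comp (is_derive_poly P t^-1) dV.
  have dE := is_derive1_comp (f := expR) (g := fun s => - s^-1) (is_derive_expR (- t^-1)) dN.
  apply: near_eq_is_derive ff _; apply: is_derive_eq (is_deriveM dP dE) _.
  rewrite /flat t0 /flat_deriv !hornerE /= /GRing.scale/= -exprVn.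
  ring.
- rewrite [X in is_derive _ _ _ X](_ : _ = 0); last by rewrite /flat ltxx.
  (* One factor 1/h comes from the difference quotient at 0; the second is offset by a factor h,
     which forces the quotient to 0. *)
  have [C HC] := horner_expRN_bounded ('X * 'X * P).
  have C0 : 0 <= C by apply: le_trans (HC 0 _).
  (* C may be 0, while C + 1 can be divided by. *)
  have C1 : 0 < C + 1 by rewrite ltr_wpDl.
  have H (h : R) : `|h^-1 * flat P h| <= C * `|h|.
    rewrite /flat; case: ifPn => h0; last by rewrite mulr0 normr0 mulr_ge0.
    have hV : 0 <= h^-1 by rewrite invr_ge0 ltW.
    have Hh : `|h^-1 * h^-1 * P.[h^-1] * expR (- h^-1)| <= C.
      by have := HC _ hV; rewrite !hornerM hornerX.
    rewrite [X in `|X| <= _](_ : _ = h^-1 * h^-1 * P.[h^-1] * expR (- h^-1) * h).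
      by rewrite normrM ler_wpM2r.
    by field; rewrite gt_eqF.
  have cv : h^-1 *: ((flat P \o shift 0) (h *: (1 : R)) - flat P 0) @[h --> 0^'] --> (0 : R).
    apply/cvgr0Pnorm_lt => e e0; near=> h.
    rewrite /= scaler1 addr0 [in X in _ - X]/flat ltxx subr0.
    apply: (le_lt_trans (H h)).
    apply: (@le_lt_trans _ _ ((C + 1) * `|h|)).
      by rewrite ler_wpM2r// lerDl.
    rewrite mulrC -ltr_pdivlMr//; near: h.
    apply: dnbhs0_lt; exact: divr_gt0.
  have dv : derivable (flat P) 0 1 by apply: cvgP cv.
  apply: DeriveDef => //; exact: cvg_lim cv.
Unshelve. all: by end_near. Qed.

Lemma continuous_flat P : continuous (flat P).
Proof.
move=> t; apply: differentiable_continuous; apply/derivable1_diffP.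
by have [] := is_derive_flat P t.
Qed.

Lemma flat1_ge0 t : 0 <= flat 1 t.
Proof. by rewrite /flat hornerE mul1r; case: ifP => // _; exact: expR_ge0. Qed.

Lemma flat1_le1 t : flat 1 t <= 1.
Proof.
rewrite /flat hornerE mul1r; case: ifP => // t0.
by rewrite expR_le1 oppr_le0 invr_ge0 ltW.
Qed.

Lemma flat1_neq0 t : (flat 1 t != 0) = (0 < t).
Proof.
by rewrite /flat hornerE mul1r; case: ifP => _; rewrite ?eqxx// gt_eqF// expR_gt0.
Qed.

End flat.

(** * Smooth functions, and those constant along a direction *)

Section smooth_closure.
Context (R : realType) (N : nat).
Implicit Types (f g : 'rV[R]_N -> R) (d : 'rV[R]_N).
Local Notation basis i := (delta_mx ord0 i : 'rV[R]_N).

(** Counting the order of differentiation gives the induction behind Leibniz' rule: the derivative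
    of a product is a sum of products of functions of lower order. *)
Fixpoint Ck k f : Prop := continuous f /\
  (if k is k'.+1 then forall i, (forall x, derivable f x (basis i)) /\ Ck k' (partial i f)
   else True).

Lemma CkS k f : Ck k.+1 f -> Ck k f.
Proof.
elim: k f => [f [cf _]//|k IH f [cf df]]; split=> // i.
by have [dfi Cfi] := df i; split => //; exact: IH.
Qed.

Lemma Ck_continuous k f : Ck k f -> continuous f.
Proof. by case: k => [|k] []. Qed.

Lemma iter_partial_rcons s i f : iter_partial (rcons s i) f = iter_partial s (partial i f).
Proof. by rewrite /iter_partial foldr_rcons. Qed.

(** [foldr] applies the last entry of the word first, and [Ck] peels off the derivative taken first;
    hence the induction from the right end of the word. *)
Lemma smoothP f : smooth f <-> forall k, Ck k f.
Proof.
split=> [sf k|Cf s].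
  elim: k f sf => [|k IH] f sf; have [cf df] := sf [::]; split => // i.
  split; first exact: df.
  by apply: IH => s; rewrite -iter_partial_rcons; exact: sf.
elim/last_ind: s f Cf => [|s i IH] f Cf.
  split=> [|i x]; first exact: (Ck_continuous (Cf 0%N)).
  by have [_ /(_ i)[]] := Cf 1%N.
rewrite iter_partial_rcons; apply: IH => k.
by have [_ /(_ i)[]] := Cf k.+1.
Qed.

Lemma smooth_continuous f : smooth f -> continuous f.
Proof. by move=> /(_ [::])[]. Qed.

Lemma smooth_derivable f i x : smooth f -> derivable f x (basis i).
Proof. by move=> /(_ [::])[_]; exact. Qed.

Lemma smooth_partial f i : smooth f -> smooth (partial i f).
Proof. by move=> sf s; rewrite -iter_partial_rcons; exact: sf. Qed.

Lemma partial_cst (i : 'I_N) (a : R) : partial i (fun=> a) = fun=> 0.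
Proof. by apply/funext => x; rewrite /partial derive_cst. Qed.

Lemma partialD i f g :
  (forall x, derivable f x (basis i)) -> (forall x, derivable g x (basis i)) ->
  partial i (fun x => f x + g x) = fun x => partial i f x + partial i g x.
Proof. by move=> df dg; apply/funext => x; rewrite /partial deriveD. Qed.

Lemma partialM i f g :
  (forall x, derivable f x (basis i)) -> (forall x, derivable g x (basis i)) ->
  partial i (fun x => f x * g x) = fun x => f x * partial i g x + g x * partial i f x.
Proof. by move=> df dg; apply/funext => x; rewrite /partial deriveM. Qed.

Lemma Ck_cst k (a : R) : Ck k (fun=> a).
Proof.
elim: k a => [|k IH] a; split; [exact: cst_continuous|by []|exact: cst_continuous|].
by move=> i; rewrite partial_cst; split => // x; exact: derivable_cst.
Qed.

Lemma CkD k f g : Ck k f -> Ck k g -> Ck k (fun x => f x + g x).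
Proof.
elim: k f g => [|k IH] f g [cf df] [cg dg]; split => //.
- by move=> x; apply: continuousD; [exact: cf|exact: cg].
- by move=> x; apply: continuousD; [exact: cf|exact: cg].
- move=> i; have [dfi Cf] := df i; have [dgi Cg] := dg i.
  rewrite (partialD dfi dgi); split; last exact: IH.
  by move=> x; apply: derivableD; [exact: dfi|exact: dgi].
Qed.

Lemma CkM k f g : Ck k f -> Ck k g -> Ck k (fun x => f x * g x).
Proof.
elim: k f g => [|k IH] f g Cf Cg; have cf := Ck_continuous Cf;
  have cg := Ck_continuous Cg; split => //.
- by move=> x; apply: continuousM; [exact: cf|exact: cg].
- by move=> x; apply: continuousM; [exact: cf|exact: cg].
- move=> i; have [_ /(_ i)[dfi Cfi]] := Cf; have [_ /(_ i)[dgi Cgi]] := Cg.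
  rewrite (partialM dfi dgi); split.
    by move=> x; apply: derivableM; [exact: dfi|exact: dgi].
  (* Leibniz' rule leaves one factor undifferentiated; [CkS] lowers its order to that of the
     induction hypothesis. *)
  by apply: CkD; apply: IH => //; exact: CkS.
Qed.

Lemma smooth_cst (a : R) : smooth ((fun=> a) : 'rV[R]_N -> R).
Proof. by apply/smoothP => k; exact: Ck_cst. Qed.

Lemma smoothD f g : smooth f -> smooth g -> smooth (fun x => f x + g x).
Proof. by move=> /smoothP sf /smoothP sg; apply/smoothP => k; exact: CkD. Qed.

Lemma smoothM f g : smooth f -> smooth g -> smooth (fun x => f x * g x).
Proof. by move=> /smoothP sf /smoothP sg; apply/smoothP => k; exact: CkM. Qed.

Section affine.
Variables (l : 'rV[R]_N -> R) (a : 'rV[R]_N -> R).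
Hypothesis la : forall x v t, l (t *: v + x) = t * a v + l x.

(** On the line through x in direction v the function depends on one real variable, so the
    one-dimensional chain rule is enough. *)
Lemma is_derive_flat_affine P x v :
  is_derive x v (flat P \o l) (a v * flat (flat_deriv P) (l x)).
Proof.
have D : is_derive (0 : R) (1 : R) (fun t : R => (flat P \o l) (t *: v + x))
    (a v * flat (flat_deriv P) (l x)).
  rewrite (_ : (fun t : R => _) = flat P \o (fun t : R => t * a v + l x)); last first.
    by apply/funext => t /=; rewrite la.
  have dg : is_derive (0 : R) (1 : R) (fun t : R => t * a v + l x) (a v).
    have := is_deriveD (is_deriveM (is_derive_id (0 : R) (1 : R))
      (is_derive_cst (a v) (0 : R) (1 : R))) (is_derive_cst (l x) (0 : R) (1 : R)).
    by move=> D; apply: is_derive_eq D _; rewrite /GRing.scale/=; ring.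
  have := is_derive1_comp (is_derive_flat P ((fun t : R => t * a v + l x) 0)) dg.
  by rewrite mul0r add0r mulrC.
have [dF eF] := D; split; first exact/derivable1P.
rewrite -eF /derive.
set q1 := (fun h => _); set q2 := (fun h => _); suff -> : q1 = q2 by [].
by apply/funext => h; rewrite /q1 /q2/= scale0r add0r addr0 [h *: 1]mulr1.
Qed.

Lemma Ck_flat_affine k P : continuous l -> Ck k (fun x => flat P (l x)).
Proof.
move=> cl.
have cF Q : continuous (fun x => flat Q (l x)).
  by move=> x; apply: continuous_comp; [exact: cl|exact: continuous_flat].
elim: k P => [|k IH] P; split => // i.
have D x := is_derive_flat_affine P x (basis i).
split=> [x|]; first by have [] := D x.
rewrite (_ : partial i _ = fun x => a (basis i) * flat (flat_deriv P) (l x)).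
  by apply: CkM (IH _); exact: Ck_cst.
by apply/funext => x; rewrite /partial; have [_ ->] := D x.
Qed.

Lemma smooth_flat_affine P : continuous l -> smooth (fun x => flat P (l x)).
Proof. by move=> cl; apply/smoothP => k; exact: Ck_flat_affine. Qed.

End affine.

(** Constancy along d in terms of partial derivatives, the form that the weak identities use:
    closure under sums and products becomes algebra. *)
Definition smooth_along d f :=
  smooth f /\ forall x, \sum_i d ord0 i * partial i f x = 0.

Lemma smooth_along_cst d (a : R) : smooth_along d (fun=> a).
Proof.
split=> [|x]; first exact: smooth_cst.
by rewrite big1// => i _; rewrite partial_cst mulr0.
Qed.

Lemma smooth_alongD d f g :
  smooth_along d f -> smooth_along d g -> smooth_along d (fun x => f x + g x).
Proof.
move=> [sf df] [sg dg]; split=> [|x]; first exact: smoothD.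
rewrite (eq_bigr (fun i => d ord0 i * partial i f x + d ord0 i * partial i g x)).
  by rewrite big_split/= df dg addr0.
move=> i _; rewrite -mulrDr partialD// => y; exact: smooth_derivable.
Qed.

Lemma smooth_alongM d f g :
  smooth_along d f -> smooth_along d g -> smooth_along d (fun x => f x * g x).
Proof.
move=> [sf df] [sg dg]; split=> [|x]; first exact: smoothM.
rewrite (eq_bigr (fun i => f x * (d ord0 i * partial i g x) +
    g x * (d ord0 i * partial i f x))).
  by rewrite big_split/= -!mulr_sumr df dg !mulr0 addr0.
move=> i _; rewrite partialM => [|y|y]; [ring|exact: smooth_derivable..].
Qed.

Lemma smooth_along_prod d I (s : seq I) (f : I -> 'rV[R]_N -> R) :
  (forall i, smooth_along d (f i)) -> smooth_along d (fun x => \prod_(i <- s) f i x).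
Proof.
move=> sf; elim: s => [|i s IH].
  rewrite (_ : (fun=> _) = fun=> 1); first exact: smooth_along_cst.
  by apply/funext => x; rewrite big_nil.
rewrite (_ : (fun=> _) = fun x => f i x * \prod_(i <- s) f i x).
  exact: smooth_alongM.
by apply/funext => x; rewrite big_cons.
Qed.

Lemma smooth_along_exp d f k : smooth_along d f -> smooth_along d (fun x => f x ^+ k).
Proof.
move=> sf; have := smooth_along_prod (index_enum 'I_k) (fun=> sf).
by congr smooth_along; apply/funext => x; rewrite prodr_const card_ord.
Qed.

Lemma smooth_along_flat d (l a : 'rV[R]_N -> R) P : continuous l ->
  (forall x v t, l (t *: v + x) = t * a v + l x) ->
  \sum_i d ord0 i * a (basis i) = 0 ->
  smooth_along d (fun x => flat P (l x)).
Proof.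
move=> cl la ad; split=> [|x]; first exact: smooth_flat_affine la P cl.
rewrite (eq_bigr (fun i => d ord0 i * a (basis i) * flat (flat_deriv P) (l x))).
  by rewrite -mulr_suml ad mul0r.
move=> i _; rewrite /partial; have [_ ->] := is_derive_flat_affine la P x (basis i).
by rewrite mulrA.
Qed.

End smooth_closure.

Lemma continuous_affine (R : realType) (T : topologicalType) (f : T -> R) (s c r : R) :
  continuous f -> continuous (fun x => s * (f x - c) + r).
Proof.
move=> cf x; apply: cvgD; last exact: cvg_cst.
by apply: cvgM; [exact: cvg_cst|apply: cvgB; [exact: cf|exact: cvg_cst]].
Qed.

(** * Cutoffs constant along the kernel of a linear map *)

Section cutoff.
Context (R : realType) (N m : nat) (M : 'M[R]_(N, m)).

Lemma continuous_mulmxr_coord j : continuous (fun x : 'rV[R]_N => (x *m M) ord0 j).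
Proof.
rewrite (_ : (fun x => _) = fun x : 'rV[R]_N => \sum_k x ord0 k * M k j); last first.
  by apply/funext => x; rewrite mxE.
apply: continuous_big => [|k _ x]; first exact: add_continuous.
by apply: continuousM; [exact: coord_continuous|exact: cst_continuous].
Qed.

Lemma continuous_mulmxr : continuous (fun x : 'rV[R]_N => x *m M).
Proof.
move=> x U [/= V Vx VU].
have H (ij : 'I_1 * 'I_m) : \forall z \near x, V ij.1 ij.2 ((z *m M) ij.1 ij.2).
  by case: ij => i j; rewrite (ord1 i); exact: (@continuous_mulmxr_coord j x).
have FF : Filter (nbhs x) by exact: nbhs_filter.
have {}H := filter_forall FF H.
change (nbhs x [set z | U (z *m M)]).
by apply: filterS H => z Vz; apply: VU => i j; exact: (Vz (i, j)).
Qed.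

Lemma closed_preimage_closed_rat_cube q : closed [set x : 'rV[R]_N | closed_rat_cube q (x *m M)].
Proof.
rewrite (_ : mkset _ = \bigcap_(i in [set: 'I_m]) ((fun x : 'rV[R]_N => (x *m M) ord0 i) @^-1`
    closed_ball (ratr (q.1 ord0 i) : R) (q.2.+1%:R^-1))).
  apply: closed_bigI => i _; apply: preimage_closed; last exact: closed_ball_closed.
  by move=> x _; exact: continuous_mulmxr_coord.
apply/seteqP; split => x xq i => [_|]; have := xq i;
by rewrite ?closed_ballE ?invr_gt0// /closed_ball_/= distrC//; apply.
Qed.

(* The coefficient [1] lets both factors be instances of a single affine form. *)
Definition bump (q : 'rV[rat]_m * nat) (x : 'rV[R]_N) : R :=
  \prod_(i < m) (flat 1 (1 * ((x *m M) ord0 i - ratr (q.1 ord0 i)) + q.2.+1%:R^-1) *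
                 flat 1 (-1 * ((x *m M) ord0 i - ratr (q.1 ord0 i)) + q.2.+1%:R^-1)).

Lemma bump_ge0 q x : 0 <= bump q x.
Proof. by apply: prodr_ge0 => i _; rewrite mulr_ge0 ?flat1_ge0. Qed.

Lemma bump_le1 q x : bump q x <= 1.
Proof.
apply: numdomain.Num.Theory.prodr_ile1 => i _; rewrite mulr_ge0 ?flat1_ge0//=.
by rewrite mulr_ile1 ?flat1_ge0 ?flat1_le1.
Qed.

Lemma bump_neq0 q x : bump q x != 0 <-> rat_cube q (x *m M).
Proof.
split=> [/prodf_neq0 xq i|xq].
  have := xq i isT; rewrite mulf_eq0 negb_or => /andP[].
  rewrite !flat1_neq0 mul1r mulN1r => a b.
  by rewrite ltr_norml; apply/andP; split; rewrite -subr_gt0 ?opprK // addrC.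
apply/prodf_neq0 => i _; have := xq i; rewrite ltr_norml => /andP[a b].
rewrite mulf_neq0 ?flat1_neq0 ?mul1r ?mulN1r //.
  by rewrite -[X in _ + X]opprK subr_gt0.
by rewrite addrC subr_gt0.
Qed.

Lemma smooth_along_bump (d : 'rV[R]_N) q : d *m M = 0 -> smooth_along d (bump q).
Proof.
move=> dM; apply: smooth_along_prod => i.
have A (s : R) : smooth_along d (fun x =>
    flat 1 (s * ((x *m M) ord0 i - ratr (q.1 ord0 i)) + q.2.+1%:R^-1)).
  apply: (smooth_along_flat (a := fun v => s * (v *m M) ord0 i)).
  - by apply: (@continuous_affine R 'rV[R]_N (fun x => (x *m M) ord0 i)); exact: continuous_mulmxr_coord.
  - by move=> x v t; rewrite mulmxDl -scalemxAl !mxE; ring.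
  - under eq_bigr do rewrite mulrCA -rowE mxE.
    by rewrite -mulr_sumr; have /rowP/(_ i) := dM; rewrite !mxE => ->; rewrite mulr0.
by apply: smooth_alongM; exact: A.
Qed.

Variable E : set 'rV[R]_m.
Hypothesis closedE : closed E.

(** Indices that code no cube, or a closed cube meeting E, receive the zero function, so that finite
    products run over initial segments of the naturals. *)
Definition bumps (j : nat) : 'rV[R]_N -> R :=
  if unpickle j is Some q then
    if `[< closed_rat_cube q `<=` ~` E >] then bump q else fun=> 0
  else fun=> 0.

(* The exponent k makes the product tend to 0 wherever some bump is positive. *)
Definition cutoff k x : R := 1 - \prod_(j < k) (1 - bumps j x) ^+ k.

Lemma bumps_itv j x : 0 <= 1 - bumps j x <= 1.
Proof.
rewrite subr_ge0 gerBl /bumps; case: (unpickle j) => [q|]; last by rewrite ler01 lexx.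
by case: ifP => _; rewrite ?bump_le1 ?bump_ge0// ler01 lexx.
Qed.

Lemma cutoff_itv k x : 0 <= cutoff k x <= 1.
Proof.
rewrite subr_ge0 gerBl andbC.
have H (j : 'I_k) : 0 <= (1 - bumps j x) ^+ k <= 1.
  by have /andP[b0 b1] := bumps_itv j x; rewrite exprn_ge0//= exprn_ile1.
by rewrite prodr_ge0/= ?numdomain.Num.Theory.prodr_ile1// => j _; have /andP[] := H j.
Qed.

Lemma smooth_along_cutoff (d : 'rV[R]_N) k : d *m M = 0 -> smooth_along d (cutoff k).
Proof.
move=> dM.
have oppS (f : 'rV[R]_N -> R) : smooth_along d f -> smooth_along d (fun x => 1 - f x).
  move=> sf; have := smooth_alongD (smooth_along_cst d 1)
    (smooth_alongM (smooth_along_cst d (-1)) sf).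
  by congr smooth_along; apply/funext => x; rewrite mulN1r.
have bS j : smooth_along d (bumps j).
  rewrite /bumps; case: (unpickle j) => [q|]; last exact: smooth_along_cst.
  by case: ifP => _; [exact: smooth_along_bump|exact: smooth_along_cst].
apply: (oppS _); apply: smooth_along_prod => j; apply: smooth_along_exp.
exact: (oppS _ (bS j)).
Qed.

(** Finitely many closed cubes, all disjoint from E, carry the function. Vanishing over E alone
    would not keep the closure of its nonzero set away from K. *)
Lemma cutoff_support k : exists C, [/\ closed C, [set x | cutoff k x != 0] `<=` C &
  forall x, E (x *m M) -> ~ C x].
Proof.
pose C (j : nat) : set 'rV[R]_N := if unpickle j is Some q then
    if `[< closed_rat_cube q `<=` ~` E >] then
      [set x : 'rV[R]_N | closed_rat_cube q (x *m M)] else set0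
  else set0.
exists (\bigcup_(j in `I_k) C j); split.
- apply: closed_bigcup => // j _; rewrite /C; case: (unpickle j) => [q|]; last exact: closed0.
  by case: ifP => _; [exact: closed_preimage_closed_rat_cube|exact: closed0].
- move=> x; apply: contra_neqP => xC; rewrite /cutoff big1 ?subrr// => j _.
  suff -> : bumps j x = 0 by rewrite subr0 expr1n.
  apply/eqP; apply/negPn/negP => bx; apply: xC; exists (j : nat); first exact: ltn_ord.
  move: bx; rewrite /C /bumps; case: (unpickle j) => [q|]; last by rewrite eqxx.
  case: ifP => _; last by rewrite eqxx.
  by move=> /bump_neq0 xq i; exact/ltW/xq.
- move=> x xE [j _]; rewrite /C; case: (unpickle j) => [q|//].
  by case: asboolP => // qE /qE.
Qed.

(** A single bump with value b > 0 at x suffices: once k exceeds its index, the product is at most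
    (1 - b)^k. *)
Lemma cutoff_cvg x : ~ E (x *m M) -> cutoff ^~ x @ \oo --> (1 : R).
Proof.
move=> xE; have [q [xq qE]] := open_rat_cube (closed_openC closedE) xE.
pose b := bumps (pickle q) x.
have b0 : b != 0 by rewrite /b /bumps pickleK asboolT//; exact/bump_neq0.
have /andP[b1 b2] := bumps_itv (pickle q) x.
have bexp : (1 - (1 - b) ^+ k) @[k --> \oo] --> (1 : R).
  rewrite -[X in _ --> X]subr0; apply: cvgB; first exact: cvg_cst.
  apply: cvg_expr; rewrite ger0_norm// ltrBlDr ltrDl lt_neqAle eq_sym b0/=.
  by rewrite -(gerBl 1).
apply: (squeeze_cvgr (f := fun k => 1 - (1 - b) ^+ k) (h := fun=> 1) _ bexp); last exact: cvg_cst.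
near=> k.
have /andP[_ ->] := cutoff_itv k x; rewrite andbT lerB//.
have qk : (pickle q < k)%N by near: k; exact: nbhs_infty_gt.
rewrite (bigD1 (Ordinal qk))//= -[leRHS]mulr1 ler_wpM2l ?exprn_ge0//.
apply: numdomain.Num.Theory.prodr_ile1 => j _; have /andP[c0 c1] := bumps_itv j x.
by rewrite exprn_ge0//= exprn_ile1.
Unshelve. all: by end_near. Qed.

End cutoff.

(** * Removability *)

Section projection.
Context (R : realType) (N : nat).
Implicit Types (d x : 'rV[R]_N) (B : 'M[R]_(N.-1, N)) (K : set 'rV[R]_N).

Lemma orthonormal_frame_decomp d B x : d != 0 -> orthonormal_frame d B ->
  exists t, x = x *m B^T *m B + t *: d.
Proof.
move=> d0 [BB dB].
(* [N.-1] is truncated: the kernel has rank N - N.-1, which is 1 only for positive N. *)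
have N0 : (0 < N)%N.
  by case: N d d0 {B x BB dB} => // d; rewrite (thinmx0 d) eqxx.
have rB : \rank (kermx B^T) = 1%N.
  have Bfree : row_free B by apply/row_freeP; exists B^T.
  by rewrite mxrank_ker mxrank_tr (eqP Bfree) -subn1 subKn.
have dK : (d <= kermx B^T)%MS by apply/sub_kermxP.
have vK : (x - x *m B^T *m B <= kermx B^T)%MS.
  by apply/sub_kermxP; rewrite mulmxBl -!mulmxA BB mulmx1 subrr.
have Kd : (kermx B^T <= d)%MS.
  by rewrite -(mxrank_leqif_sup dK).2 rB rank_rV d0.
have /sub_rVP[t xt] := submx_trans vK Kd.
by exists t; rewrite -xt addrC subrK.
Qed.

(** The null set lives in R^(N-1); its preimage under [*m B^T] is null in R^N because [*m B] is a
    section of that projection. Each z in K lies on the same line as its foot [z *m B^T *m B], so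
    the given set contains the projection of K. *)
Lemma projection_null d B K : d != 0 -> orthonormal_frame d B ->
  completed_lebesgue_rV [set y | exists2 L, lines_meeting d K L & L (y *m B)] = 0%E ->
  exists Z, [/\ measurable Z, lebesgue_rV Z = 0%E &
    forall x, [set z *m B^T | z in K] (x *m B^T) -> Z x].
Proof.
move=> d0 fB /completed_lebesgue_rV_null[Z [mZ YZ Z0]].
have [BB dB] := fB.
have mP := measurable_mulmxr B^T.
exists ((fun x : 'rV[R]_N => x *m B^T) @^-1` Z); split.
- by rewrite -[X in measurable X]setTI; exact: mP.
- apply: (@lebesgue_rV_preimage_null _ _ _ _ (fun y => y *m B)) => // x y.
  by rewrite mulmxDl -mulmxA BB mulmx1.
- move=> x [z Kz zx]; rewrite /preimage/= -zx; apply: YZ.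
  exists (line d z).
    by split; [exists z|exists z; split => //; exists 0 => //; rewrite scale0r addr0].
  have [t zt] := orthonormal_frame_decomp z d0 fB.
  by exists (- t) => //; rewrite {1}zt scaleNr addrK.
Qed.

End projection.

(** * Supports of test functions *)

Section test_functions.
Context (R : realType) (N : nat).
Implicit Types (phi psi : 'rV[R]_N -> R) (Omega K : set 'rV[R]_N).

Lemma notin_tsupport phi x : ~ tsupport phi x -> \forall y \near x, phi y = 0.
Proof.
move=> xs; have : open (~` tsupport phi) by apply: closed_openC; exact: closed_closure.
rewrite openE => /(_ _ xs); rewrite /interior; apply: filterS => y ys.
by apply/eqP/negPn/negP => y0; apply: ys; exact: subset_closure.
Qed.

Lemma tsupport_partial phi i x : ~ tsupport phi x -> partial i phi x = 0.
Proof.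
move=> /notin_tsupport xs; rewrite /partial.
rewrite -(@near_eq_derive _ _ _ (cst 0) phi); first by rewrite derive_cst.
by apply: filterS xs => y ->.
Qed.

Lemma tsupport_eq0 phi x : ~ tsupport phi x -> phi x = 0.
Proof. by move=> xs; apply/eqP/negPn/negP => x0; apply: xs; exact: subset_closure. Qed.

Lemma test_function_mul_cutoff m (M : 'M[R]_(N, m)) E K phi k : closed E ->
  (forall x, K x -> E (x *m M)) -> test_function setT phi ->
  test_function (~` K) (fun x => phi x * cutoff M E k x).
Proof.
move=> cE KE [sphi cphi _].
have [C [cC suppC EC]] := cutoff_support M E k.
split.
- apply: smoothM; first exact: sphi.
  (* Only the smoothness of the cutoff is wanted here, so the direction is taken to be 0. *)
  have M0 : (0 : 'rV[R]_N) *m M = 0 by rewrite mul0mx.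
  by have [] := smooth_along_cutoff E k M0.
- apply: (subclosed_compact _ cphi); first exact: closed_closure.
  apply: closure_subset => x /=; apply: contra_neq => ->.
  by rewrite mul0r.
- move=> x xs Kx; apply: (EC x (KE _ Kx)).
  apply: cC; apply: closure_subset xs => y /= y0; apply: suppC => /=.
  by apply: contra_neq y0 => ->; rewrite mulr0.
Qed.

Lemma continuous_compact_bounded phi (S : set 'rV[R]_N) : continuous phi -> compact S ->
  (forall x, ~ S x -> phi x = 0) -> exists2 A, 0 <= A & forall x, `|phi x| <= A.
Proof.
move=> cphi cS S0.
have /compact_bounded[A [_ /(_ (`|A| + 1))]] : compact (phi @` S).
  by apply: continuous_compact => //; exact: continuous_subspaceT.
rewrite ltr_pwDr ?ler_norm// => /(_ isT) HA.
exists (`|A| + 1) => [|x]; first by rewrite addr_ge0.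
have [Sx|nSx] := pselect (S x); first by apply: HA; exists x.
by rewrite S0// normr0 addr_ge0.
Qed.

End test_functions.

(** * Limits and linear combinations of integrals *)

Section integration.
Context d (T : measurableType d) (R : realType) (mu : {measure set T -> \bar R}).
Implicit Types f g : T -> R.
Local Open Scope ereal_scope.

Lemma integral_cutoff_eq0 f (chi : nat -> T -> R) :
  mu.-integrable setT (EFin \o f) -> (forall k, measurable_fun setT (chi k)) ->
  (forall k x, 0 <= chi k x <= 1)%R ->
  {ae mu, forall x, chi ^~ x @ \oo --> (1 : R)%R} ->
  (forall k, \int[mu]_x (chi k x * f x)%:E = 0) -> \int[mu]_x (f x)%:E = 0.
Proof.
move=> intf mchi chi01 chi1 chif0.
have mf : measurable_fun setT f by apply/measurable_EFinP; exact: measurable_int intf.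
have [||||| _ _] := @dominated_convergence _ _ _ mu setT measurableT
    (fun k x => (chi k x * f x)%:E) (EFin \o f) (abse \o (EFin \o f)).
- by move=> k; apply/measurable_EFinP; exact: measurable_funM.
- exact/measurable_EFinP.
- apply: filterS chi1 => x chix _ /=; apply/fine_cvgP; split; first exact: nearW.
  by rewrite -[X in _ --> X]mul1r; apply: cvgMl.
- exact: integrable_abse.
- apply: aeW => x k _ /=; rewrite lee_fin normrM ler_piMl//.
  by have /andP[c0 c1] := chi01 k x; rewrite ger0_norm.
rewrite (_ : [sequence _]_n = cst 0); last by apply/funext => k /=; exact: chif0.
by move=> /cvg_lim <- //; rewrite lim_cst.
Qed.

(** Puts the weak identity into a single integrand, which can be multiplied by a cutoff. Moving a
    term across an equation between extended reals relies on finiteness. *)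
Lemma integral_eqN f g :
  mu.-integrable setT (EFin \o f) -> mu.-integrable setT (EFin \o g) ->
  (\int[mu]_x (f x)%:E = - \int[mu]_x (g x)%:E) <-> (\int[mu]_x (f x + g x)%:E = 0).
Proof.
move=> intf intg.
under [X in _ <-> X = _]eq_integral do rewrite EFinD.
rewrite (integralD_EFin measurableT intf intg).
have /fineK <- := integrable_fin_num measurableT intf.
have /fineK <- := integrable_fin_num measurableT intg.
rewrite -EFinN -EFinD; split=> [[->]|[/eqP]]; first by rewrite addNr.
by rewrite addr_eq0 => /eqP ->.
Qed.

(** [fine] places the integrals in the field R, where the matrix of directions can act on them. *)
Lemma integral_lincomb n (a : 'I_n -> R) (h : 'I_n -> T -> R) :
  (forall i, mu.-integrable setT (EFin \o h i)) ->
  mu.-integrable setT (EFin \o (fun x => \sum_i a i * h i x)%R) /\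
  \int[mu]_x (\sum_i a i * h i x)%R%:E =
  (\sum_i a i * fine (\int[mu]_x (h i x)%:E))%R%:E.
Proof.
move=> inth.
have intah i : mu.-integrable setT (fun x => (a i)%:E * (h i x)%:E).
  exact: (integrableZl measurableT (a i) (inth i)).
have E x : (\sum_i a i * h i x)%R%:E = \sum_i (a i)%:E * (h i x)%:E.
  by rewrite -sumEFin; apply: eq_bigr => i _; rewrite EFinM.
split; first by rewrite (_ : _ \o _ = fun x => \sum_i (a i)%:E * (h i x)%:E);
  [exact: integrable_sum|exact/funext].
under eq_integral do rewrite E.
rewrite integral_sum// -sumEFin; apply: eq_bigr => i _.
rewrite integralZl//; last exact: inth.
by rewrite EFinM fineK//; apply: integrable_fin_num => //; exact: inth.
Qed.

End integration.

(** * L^p functions against compactly supported factors *)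

Section Lp.
Context (R : realType) (N : nat) (p : R).
Local Notation mu := (@completed_lebesgue_rV R N).
Implicit Types (u g psi : 'rV[R]_N -> R) (K : set 'rV[R]_N).
Local Open Scope ereal_scope.

Lemma Lp_norm_ae u v : (p != 0)%R -> lebesgue_measurable_fun setT u ->
  lebesgue_measurable_fun setT v -> {ae mu, forall x, u x = v x} ->
  Lp_norm p setT u = Lp_norm p setT v.
Proof.
move=> p0 mu_ mv uv; rewrite /Lp_norm unlock !patch_setT; congr (_ `^ _).
have mp w : lebesgue_measurable_fun setT w ->
    measurable_fun setT (fun x : lebesgueTypeRV R N => `|(w x)%:E| `^ p).
  move=> mw; rewrite (_ : (fun _ => _) = fun x : lebesgueTypeRV R N => (`|w x| `^ p)%:E)//.
  apply/measurable_EFinP; apply: (measurableT_comp (measurable_powR p)).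
  exact: measurableT_comp.
apply: ae_eq_integral; [exact: measurableT|exact: mp|exact: mp|].
case: uv => Z [mZ Z0 uvZ]; exists Z; split => // x /= uvx; apply: uvZ => /= uv.
by apply: uvx => _; rewrite uv.
Qed.

(** In place of Hölder's inequality: |u| <= 1 + |u|^p for p >= 1, and the 1 counts only on a cube
    containing S, so A (1_cube + |u|^p) dominates. *)
Lemma integrable_Lp_mul u psi (S : set 'rV[R]_N) : (1 <= p)%R ->
  lebesgue_measurable_fun setT u -> Lp_norm p setT u < +oo ->
  continuous psi -> compact S -> (forall x, ~ S x -> psi x = 0%R) ->
  mu.-integrable setT (fun x => (u x * psi x)%:E).
Proof.
move=> p1 mu_ up cpsi cS S0.
have p0 : (p != 0)%R by rewrite gt_eqF// (lt_le_trans ltr01).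
have [A A0 psiA] := continuous_compact_bounded cpsi cS S0.
have [M SM] := compact_sub_cube cS.
have mpsi := continuous_lebesgue_measurable_fun cpsi.
have mC : measurable (cube M : set (lebesgueTypeRV R N)).
  by apply: measurable_lebesgueTypeRV; exact: measurable_cube.
have intC : mu.-integrable setT (EFin \o (\1_(cube M) : lebesgueTypeRV R N -> R)).
  apply/integrableP; split; first by apply/measurable_EFinP; exact: measurable_indic.
  under eq_integral => x _ do rewrite /= ger0_norm// indicE.
  rewrite integral_indic// setIT.
  rewrite [X in X < _]completed_lebesgue_rVE; first exact: lebesgue_rV_cube.
  exact: measurable_cube.
have mup : measurable_fun setT (fun x : lebesgueTypeRV R N => `|u x| `^ p)%R.
  apply: (measurableT_comp (measurable_powR p)); exact: measurableT_comp.
have intu : mu.-integrable setT (EFin \o (fun x : lebesgueTypeRV R N => `|u x| `^ p)%R).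
  apply/integrableP; split; first exact/measurable_EFinP.
  rewrite (_ : \int[_]_(_ in _) _ = 'N[mu]_(p%:E)[EFin \o u] `^ p).
    by apply: poweR_lty; move: up; rewrite /Lp_norm patch_setT.
  rewrite poweR_Lnorm//; apply: eq_integral => x _ /=.
  by rewrite ger0_norm ?powR_ge0.
have intg := integrableZl measurableT A (integrableD measurableT intC intu).
apply: le_integrable intg; first exact: measurableT.
  by apply/measurable_EFinP; exact: measurable_funM.
move=> x _ /=; rewrite lee_fin.
rewrite [leRHS]ger0_norm ?mulr_ge0 ?addr_ge0 ?powR_ge0 ?indicE//.
have [Sx|/S0 ->] := pselect (S x); last first.
  by rewrite mulr0 normr0 mulr_ge0 ?addr_ge0 ?powR_ge0.
rewrite mem_set; last exact: SM.
rewrite normrM mulrC ler_pM//=.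
have [u1|u1] := lerP `|u x|%R 1%R; first by rewrite (le_trans u1)// lerDl powR_ge0.
by apply: (@le_trans _ _ (`|u x| `^ p)%R); [apply: le1r_powR => //; exact: ltW|rewrite lerDr].
Qed.

End Lp.

Lemma row_free_row_neq0 (F : fieldType) m n (A : 'M[F]_(m, n)) i :
  row_free A -> row i A != 0.
Proof.
move=> fA; apply/negP => /eqP; rewrite rowE -(mul0mx _ A).
move=> /(row_free_inj fA)/rowP/(_ i); rewrite !mxE !eqxx => /eqP.
by rewrite oner_eq0.
Qed.

(** * Weak derivatives across K *)

Section removable.
Context (R : realType) (N : nat) (p : R).
Local Notation mu := (@completed_lebesgue_rV R N).
Implicit Types (u v phi : 'rV[R]_N -> R) (g : 'I_N -> 'rV[R]_N -> R) (K D : set 'rV[R]_N).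
Local Open Scope ereal_scope.

(** Extension by zero replaces integrals over D by integrals over R^N, where the weak identities are
    then compared. *)
Lemma integral_restrict_mul D u phi :
  \int[mu]_(x in D) (u x * phi x)%:E = \int[mu]_x ((u \_ D) x * phi x)%:E.
Proof.
rewrite integral_mkcond; apply: eq_integral => x _.
by rewrite !patchE; case: ifP => // _; rewrite mul0r.
Qed.

Lemma Lp_norm_restrict D u : Lp_norm p D u = Lp_norm p setT (u \_ D).
Proof. by rewrite /Lp_norm patch_setT. Qed.

Lemma sobolev_norm_lty D u g : sobolev_norm p D u g < +oo ->
  Lp_norm p D u < +oo /\ forall i, Lp_norm p D (g i) < +oo.
Proof.
rewrite /sobolev_norm => ug.
have g0 : 0 <= \sum_(i < N) Lp_norm p D (g i) by apply: sume_ge0 => i _; exact: Lnorm_ge0.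
split=> [|i]; apply: le_lt_trans ug; first by rewrite leeDl.
apply: (@le_trans _ _ (\sum_(i < N) Lp_norm p D (g i))); last by rewrite leeDr// Lnorm_ge0.
by rewrite (bigD1 i)//= leeDl// sume_ge0// => j _; exact: Lnorm_ge0.
Qed.

Section weak_derivative.
Variables (K : set 'rV[R]_N) (u : 'rV[R]_N -> R) (g : 'I_N -> 'rV[R]_N -> R).
Hypothesis p1 : (1 <= p)%R.
Hypothesis compactK : compact K.
Hypothesis mu_ : lebesgue_measurable_fun setT u.
Hypothesis mg : forall i, lebesgue_measurable_fun setT (g i).
Hypothesis up : Lp_norm p setT u < +oo.
Hypothesis gp : forall i, Lp_norm p setT (g i) < +oo.

Lemma integrable_test phi i : smooth phi -> compact (tsupport phi) ->
  mu.-integrable setT (fun x => (u x * partial i phi x)%:E) /\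
  mu.-integrable setT (fun x => (g i x * phi x)%:E).
Proof.
move=> sphi cphi; split.
  apply: (integrable_Lp_mul p1 mu_ up _ cphi).
    by apply: smooth_continuous; exact: smooth_partial.
  by move=> x; exact: tsupport_partial.
apply: (integrable_Lp_mul p1 (mg i) (gp i) _ cphi); first exact: smooth_continuous.
by move=> x; exact: tsupport_eq0.
Qed.

Hypothesis weak_ug : forall i phi, test_function (~` K) phi ->
  \int[mu]_x (u x * partial i phi x)%:E = - \int[mu]_x (g i x * phi x)%:E.

(* Multiplying phi by a cutoff chi that is constant along d multiplies
   sum_i d_i (u d_i phi + g_i phi) by chi. *)
Lemma weak_derivative_along (d : 'rV[R]_N) phi : d != 0%R ->
  null_lines d (lines_meeting d K) -> test_function setT phi ->
  (\sum_i d ord0 i * fine (\int[mu]_x (u x * partial i phi x + g i x * phi x)%:E) = 0)%R.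
Proof.
move=> d0 [B [fB nB]] tphi.
have [Z [mZ Z0 EZ]] := projection_null d0 fB nB.
have [sphi cphi _] := tphi.
set E := [set z *m B^T | z in K] in EZ.
have closedE : closed E.
  apply: compact_closed; first exact: norm_hausdorff.
  by apply: continuous_compact => //; apply: continuous_subspaceT; exact: continuous_mulmxr.
have dB : (d *m B^T = 0)%R by have [] := fB.
pose h psi i x := (u x * partial i psi x + g i x * psi x)%R.
have inth psi i : smooth psi -> compact (tsupport psi) ->
    mu.-integrable setT (EFin \o h psi i).
  move=> spsi cpsi; have [i1 i2] := integrable_test i spsi cpsi.
  exact: (integrableD measurableT i1 i2).
have [intf Ef] := integral_lincomb (fun i => d ord0 i) (fun i => inth phi i sphi cphi).
apply: EFin_inj; rewrite -Ef.
apply: (@integral_cutoff_eq0 _ (lebesgueTypeRV R N) R mu _ (cutoff B^T E) intf).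
- move=> k; apply: continuous_lebesgue_measurable_fun.
  by apply: smooth_continuous; have [] := smooth_along_cutoff E k dB.
- by move=> k x; exact: cutoff_itv.
(* Failure of convergence is confined to the cylinder over E, which Z covers. *)
- have [mZ' Z'0] := sub_null_lebesgueTypeRV mZ Z0 (fun x h => h).
  exists Z; split => // x /= nx; apply: EZ; apply: contrapT => xE; apply: nx.
  exact: cutoff_cvg.
- move=> k; pose psi x := (phi x * cutoff B^T E k x)%R.
  have tpsi : test_function (~` K) psi.
    by apply: test_function_mul_cutoff => // x Kx; exists x.
  have [spsi cpsi _] := tpsi.
  have [schi dchi] := smooth_along_cutoff E k dB.
  have [_] := integral_lincomb (fun i => d ord0 i) (fun i => inth psi i spsi cpsi).
  rewrite big1 => [Epsi|i _]; last first.
    have [i1 i2] := integrable_test i spsi cpsi.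
    by rewrite (iffLR (integral_eqN i1 i2)) ?mulr0//; exact: weak_ug.
  rewrite -[RHS]Epsi; apply: eq_integral => x _; congr EFin.
  rewrite [RHS](eq_bigr (fun i => cutoff B^T E k x * (d ord0 i * h phi i x) +
      u x * phi x * (d ord0 i * partial i (cutoff B^T E k) x)))%R.
    rewrite big_split/= -!mulr_sumr dchi mulr0 addr0; reflexivity.
  move=> i _; rewrite /h /psi partialM; [ring|move=> y; exact: smooth_derivable..].
Qed.

(** For a fixed phi, the defects of the N weak identities form a column c that does not depend on
    the direction; every row of the invertible matrix D annihilates it. *)
Lemma weak_derivative_removable (D : 'M[R]_N) phi i : row_free D ->
  (forall j, null_lines (row j D) (lines_meeting (row j D) K)) ->
  test_function setT phi ->
  \int[mu]_x (u x * partial i phi x)%:E = - \int[mu]_x (g i x * phi x)%:E.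
Proof.
move=> fD nD tphi; have [sphi cphi _] := tphi.
have [i1 i2] := integrable_test i sphi cphi.
apply/(integral_eqN i1 i2).
pose c := (\col_i fine (\int[mu]_x (u x * partial i phi x + g i x * phi x)%:E))%R.
have c0 : c = 0%R.
  have Du : D \in unitmx by rewrite -row_free_unit.
  rewrite -(mulKmx Du c) (_ : D *m c = 0)%R ?mulmx0//.
  apply/colP => j; rewrite !mxE.
  rewrite -[RHS](weak_derivative_along (row_free_row_neq0 j fD) (nD j) tphi).
  by apply: eq_bigr => k _; rewrite !mxE.
have /colP/(_ i) := c0; rewrite !mxE => ci.
by rewrite -[LHS]fineK ?ci//; apply: integrable_fin_num => //; exact: (integrableD measurableT i1 i2).
Qed.

End weak_derivative.

End removable.

Theorem corollary1p9 (R : realType) (N : nat) (p : R) (K : set 'rV[R]_N) :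
  (0 < N)%N -> 1 <= p -> compact K ->
  (exists D : 'M[R]_N, row_free D /\
     forall i : 'I_N, null_lines (row i D) (lines_meeting (row i D) K)) ->
  J_property p K.
Proof.
move=> N0 p1 cK [D [fD nD]].
have p0 : p != 0 by rewrite gt_eqF// (lt_le_trans ltr01).
(* K is contained in the null cylinder over its projection along the first direction, which exists
   as N is positive. *)
have [Z [mZ Z0 KZ]] : exists Z : set 'rV[R]_N,
    [/\ measurable Z, lebesgue_rV Z = 0%E & K `<=` Z].
  have [B [fB nB]] := nD (Ordinal N0).
  have [Z [mZ Z0 EZ]] := projection_null (row_free_row_neq0 _ fD) fB nB.
  by exists Z; split => // x Kx; apply: EZ; exists x.
have [mK K0] := sub_null_lebesgueTypeRV mZ Z0 KZ.
have mKc : measurable (~` K : set (lebesgueTypeRV R N)) by exact: measurableC.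
have mres u : lebesgue_measurable_fun (~` K) u -> lebesgue_measurable_fun setT (u \_ (~` K)).
  exact: (iffLR (@measurable_restrictT _ _ (lebesgueTypeRV R N) R _ u mKc)).
have aeres (u : 'rV[R]_N -> R) :
    {ae completed_lebesgue_rV (R := R) (n := N), forall x, u x = (u \_ (~` K)) x}.
  exists K; split => // x /= ux; apply: contrapT => Kx; apply: ux.
  by rewrite patchE mem_set.
have Lp_res u : lebesgue_measurable_fun setT u -> Lp_norm p (~` K) u = Lp_norm p setT u.
  move=> mu_; rewrite Lp_norm_restrict; apply/esym/Lp_norm_ae => //.
  by apply: mres; exact: measurable_funTS.
rewrite /J_property; apply/seteqP; split=> u [Qu]; have mu_ := Qu.1.
  move=> [mu' [g [mg wg ug]]]; split => //; split => //.
  have [up gp] := sobolev_norm_lty ug.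
  (* The identity is first obtained for the extension by zero; u differs from it only on the null
     set K and inherits it. *)
  have wT i phi : test_function setT phi ->
      (\int[completed_lebesgue_rV (R := R) (n := N)]_x ((u \_ (~` K)) x * partial i phi x)%:E =
       - \int[completed_lebesgue_rV (R := R) (n := N)]_x ((g i \_ (~` K)) x * phi x)%:E)%E.
    apply: (@weak_derivative_removable _ _ p K _ (fun i => g i \_ (~` K))) fD nD => //.
    - exact: mres.
    - by move=> j; exact: mres.
    - by rewrite -Lp_norm_restrict.
    - by move=> j; rewrite -Lp_norm_restrict.
    - by move=> j psi tpsi; rewrite -!integral_restrict_mul; exact: wg.
  exists (fun i => g i \_ (~` K)); split.
  - by move=> i; exact: mres.
  - move=> i phi tphi; rewrite -wT//; have [sphi _ _] := tphi.
    have mdphi := continuous_lebesgue_measurable_fun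
      (smooth_continuous (smooth_partial i sphi)).
    apply: ae_eq_integral; first exact: measurableT.
    + by apply/measurable_EFinP; exact: measurable_funM.
    + by apply/measurable_EFinP; apply: measurable_funM => //; exact: mres.
    + have [W [mW W0 uW]] := aeres u; exists W; split => // x /= nx.
      by apply: uW => /= ux; apply: nx => _; rewrite -ux.
  - rewrite /sobolev_norm -Lp_res//.
    by under eq_bigr do rewrite -Lp_norm_restrict.
move=> [_ [g [mg wg ug]]]; split => //; split; first exact: measurable_funTS mu_.
exists g; split.
- by move=> i; exact: measurable_funTS (mg i).
- move=> i phi [sphi cphi phiK].
  (* A test function supported off K vanishes on K together with its partial derivatives, so both
     domains of integration give the same value. *)
  have off psi v : (forall x, K x -> psi x = 0) ->
      (\int[completed_lebesgue_rV (R := R) (n := N)]_(x in ~` K) (v x * psi x)%:E =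
       \int[completed_lebesgue_rV (R := R) (n := N)]_x (v x * psi x)%:E)%E.
    move=> psiK; rewrite integral_restrict_mul; apply: eq_integral => x _.
    rewrite patchE; case: ifPn => // /negP; rewrite inE/= => /contrapT/psiK ->.
    by rewrite !mulr0.
  rewrite !off.
  + exact: wg.
  + by move=> x Kx; apply: tsupport_eq0 => /phiK.
  + by move=> x Kx; apply: tsupport_partial => /phiK.
- rewrite /sobolev_norm Lp_res//.
  by rewrite (eq_bigr (fun i => Lp_norm p setT (g i)))// => i _; exact: Lp_res.
Qed.
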